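(* There exists an absolute constant $c>0$ such that for every (sufficiently large) $k$ there is an instance of $0$-Extension with $k$ terminals whose optimal integral value is at least $c\log^{2/3}k$ times the optimal value of its metric relaxation $(MET)$. In other words, the metric relaxation for $0$-Extension has integrality gap $\Omega(\log^{2/3}k)$.
   Context: $0$-Extension: given an undirected graph $\mathcal{G}=(V,E)$ with non-negative edge weights $w:E\to\mathbb{R}^+$, a set $T=\{t_1,\dots,t_k\}\subseteq V$ of terminals and a semi-metric $D$ on $T$, find $f:V\to T$ with $f(t_i)=t_i$ for all $i$ minimizing $\sum_{(u,v)\in E}w_{(u,v)}D(f(u),f(v))$. The metric relaxation $(MET)$ is: minimize $\sum_{(u,v)\in E}w_{(u,v)}\delta(u,v)$ over all semi-metrics $\delta$ on $V$ satisfying $\delta(t_i,t_j)=D(t_i,t_j)$ for all terminals $t_i\neq t_j$. The integrality gap is the supremum over instances of the ratio between the optimal integral value and the optimal value of $(MET)$. *)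

(* Defs.v *)
From HB Require Import structures.
From mathcomp Require Import all_boot all_order all_algebra.
From mathcomp Require Import all_classical all_reals all_analysis.

Set Implicit Arguments.
Unset Strict Implicit.
Unset Printing Implicit Defensive.

Import Order.TTheory GRing.Theory Num.Theory.

Local Open Scope classical_set_scope.
Local Open Scope ring_scope.

(* Distinct points may be at distance 0. *)
Definition semimetric_on (R : realType) (V : finType) (A : {set V})
    (d : V -> V -> R) : Prop :=
  [/\ forall x, x \in A -> d x x = 0,
      forall x y, x \in A -> y \in A -> 0 <= d x y,
      forall x y, x \in A -> y \in A -> d x y = d y x
    & forall x y z, x \in A -> y \in A -> z \in A -> d x z <= d x y + d y z].

(* The values of [weight] off the edges and of [tdist] off the terminals are
   irrelevant. *)
Record zero_ext (R : realType) (k : nat) := ZeroExt {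
  vertex : finType;
  edge : rel vertex;
  edge_sym : symmetric edge;
  edge_irr : irreflexive edge;
  weight : vertex -> vertex -> R;
  weight_sym : forall u v, edge u v -> weight u v = weight v u;
  weight_ge0 : forall u v, edge u v -> 0 <= weight u v;
  terminals : {set vertex};
  card_terminals : #|terminals| = k;
  tdist : vertex -> vertex -> R;
  tdist_semimetric : semimetric_on terminals tdist
}.

Section ZeroExtension.
Variables (R : realType) (k : nat) (I : zero_ext R k).

(* Every undirected edge {u, v} occurs in the double sum both as (u, v) and as
   (v, u), hence the factor 1/2. *)
Definition cost (d : vertex I -> vertex I -> R) : R :=
  2^-1 * \sum_(u : vertex I) \sum_(v : vertex I | edge u v) weight u v * d u v.

Definition integral_feasible (f : vertex I -> vertex I) : Prop :=
  (forall v, f v \in terminals I) /\ (forall t, t \in terminals I -> f t = t).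

Definition integral_opt : R :=
  inf [set cost (fun u v => tdist (f u) (f v)) | f in integral_feasible].

Definition met_feasible (delta : vertex I -> vertex I -> R) : Prop :=
  semimetric_on [set: vertex I]%SET delta /\
  (forall s t, s \in terminals I -> t \in terminals I -> s != t ->
     delta s t = tdist s t).

Definition met_opt : R := inf [set cost delta | delta in met_feasible].

End ZeroExtension.

(* Instances with [met_opt I = 0], whose ratio would be 0/0, are left out. *)
Definition integrality_gap (R : realType) (k : nat) : \bar R :=
  ereal_sup [set r | exists I : zero_ext R k,
    0 < met_opt I /\ r = (integral_opt I / met_opt I)%:E].

(* Main.v *)
(* The gap instance is an extension of a sparse base graph [F] on [V] by copies
   of a Cayley graph of G = F_2^b. The generators [g i] of G form a good linear
   code, so the fibres are expanders, while [F] has girth of order b, maximum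
   degree at most 8 and at least 2|V| edges; the fibres over the ends of an edge
   [e] are matched by a random translation [s e]. With b of order q^3 and
   |V| = 2^O(q^3), fibre edges have length 1, base edges length q, and a terminal
   is hung at distance q^2 from every vertex; weights are the inverses of the
   lengths (divided by the number of generators in the fibres), so that (MET)
   costs O(1) per vertex.

   Let an integral solution move the vertices by [phi]. Unless it costs q^2 per
   vertex, [phi] is nearly constant on most fibres, moves most vertices by at
   most q^4, and sends the ends of most base edges to points at distance at most
   q^3. For a suitable h, following the displacement of [phi (v, h)] back to the
   fibre of v then gives a section [u] of the extension; since the base has large
   girth, all the closed walks involved are contractible, and
   [u e.1 + s e - u e.2] is a sum of at most q^3 generators for most edges [e].
   There are too few sections and too few such sums for this to happen for a
   random [s]. *)
Require Import Defs.
From HB Require Import structures.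
From mathcomp Require Import all_boot all_order all_algebra.
From mathcomp Require Import all_classical all_reals all_analysis.
From mathcomp Require Import fintype finset zify ring lra.
Import Order.TTheory GRing.Theory Num.Theory.
Local Open Scope ring_scope.
Set Implicit Arguments.
Unset Strict Implicit.
Unset Printing Implicit Defensive.

(** * Poincare inequality and expanding generators of F_2^b *)

(** Union bound in counting form. [good_code] and [exists_label] apply it to sets of bad objects. *)
Lemma card_cover (T J : finType) (P : pred J) (B : J -> {set T}) :
  (forall x, exists2 j, P j & x \in B j) -> (#|T| <= \sum_(j | P j) #|B j|)%N.
Proof.
move=> H; rewrite -sum1_card.
under [leqRHS]eq_bigr do rewrite -sum1_card big_mkcond /=.
rewrite exchange_big /=; apply: leq_sum => x _; have [j Pj xj] := H x.
by rewrite (bigD1 j) //= xj.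
Qed.

Section Fourier.
Variable b : nat.
Local Notation G := 'rV['F_2]_b.

Definition dot (a z : G) : 'F_2 := (a *m z^T) 0 0.

Lemma F2_cases (x : 'F_2) : x = 0 \/ x = 1.
Proof.
by case: x => -[|[|//]] i; [left|right]; apply: val_inj.
Qed.

Lemma addvv (x : G) : x + x = 0.
Proof. by apply/rowP=> j; rewrite !mxE; case: (F2_cases (x 0 j)) => ->; apply: val_inj. Qed.

Definition chi (a z : G) : int := if dot a z == 0 then 1 else -1.

Lemma dotDr a y z : dot a (y + z) = dot a y + dot a z.
Proof. by rewrite /dot linearD /= mulmxDr mxE. Qed.

Lemma dotC a z : dot a z = dot z a.
Proof.
by rewrite /dot !mxE; apply: eq_bigr => j _; rewrite !mxE mulrC.
Qed.

Lemma chiDr a y z : chi a (y + z) = chi a y * chi a z.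
Proof.
rewrite /chi dotDr.
by case: (F2_cases (dot a y)) => ->; case: (F2_cases (dot a z)) => ->.
Qed.

Lemma chi0 a : chi a 0 = 1.
Proof. by rewrite /chi /dot trmx0 mulmx0 mxE eqxx. Qed.

Lemma chiC a z : chi a z = chi z a.
Proof. by rewrite /chi dotC. Qed.

Lemma dot_delta a j : dot a (delta_mx 0 j) = a 0 j.
Proof.
rewrite /dot trmx_delta -colE mxE //.
Qed.

Lemma sum_chi (a : G) : a != 0 -> \sum_z chi a z = 0.
Proof.
move=> a0; have [j aj] : exists j, a 0 j != 0.
  apply/existsP; apply: contraNT a0; rewrite negb_exists => /forallP h.
  by apply/eqP/rowP => j; rewrite mxE; apply/eqP; rewrite -[_ == _]negbK h.
(* Translation by a basis vector on which [a] does not vanish flips every sign, so the sum is its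
   own opposite. *)
have E : \sum_z chi a z = \sum_z chi a (z + delta_mx 0 j).
  exact: (reindex_inj (addIr _)).
apply/eqP; move: E; under [X in _ = X]eq_bigr do
  rewrite chiDr [chi a (delta_mx _ _)]/chi dot_delta (negbTE aj) mulrN1.
by rewrite sumrN => /eqP; rewrite -addr_eq0 -mulr2n mulrn_eq0.
Qed.

Lemma sum_chi_delta (z : G) : \sum_a chi a z = (#|{: G}| * (z == 0%R))%N%:R.
Proof.
have [->|z0] := eqVneq z 0.
  under eq_bigr do rewrite chi0.
  by rewrite sumr_const muln1 natz.
rewrite muln0; under eq_bigr do rewrite chiC.
exact: sum_chi.
Qed.

(* The autocorrelation [r z = #{h | psi h = psi (h + z)}] has nonnegative
   Fourier coefficients, so averaging it over the generators gives at most what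
   its trivial coefficient and the bound on the other characters allow. *)
Lemma poincare (Y : finType) (psi : G -> Y) (I : finType) (g : I -> G) (w : nat) :
  (forall a, a != 0 -> (w <= #|[set i | dot a (g i) != 0%R]|)%N) ->
  (2 * w * \sum_h \sum_h' (psi h != psi h') <=
   #|{: G}| * \sum_i \sum_h (psi h != psi (h + g i)%R))%N.
Proof.
move=> gen; set m := #|{: G}|.
pose r z : int := \sum_h (psi h == psi (h + z))%:R.
pose rh a := \sum_z r z * chi a z.
have rh_ge0 a : 0 <= rh a.
  (* The sum over [y] of the squared Fourier coefficients of the indicator of [psi = y]. *)
  have -> : rh a = \sum_y (\sum_h (psi h == y)%:R * chi a h) ^+ 2.
    rewrite /rh /r.
    under eq_bigr do rewrite mulr_suml.
    rewrite exchange_big /=.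
    transitivity (\sum_h \sum_h' (psi h == psi h')%:R * (chi a h * chi a h')).
      apply: eq_bigr => h _.
      rewrite (reindex_inj (addrI h)) /=; apply: eq_bigr => h' _.
      by rewrite addrA addvv add0r -chiDr.
    under [RHS]eq_bigr do rewrite expr2 big_distrlr /=.
    rewrite [RHS]exchange_big /=; apply: eq_bigr => h _.
    rewrite [RHS]exchange_big /=; apply: eq_bigr => h' _.
    rewrite (bigD1 (psi h)) //= big1 => [|y yh].
      by rewrite eqxx addr0 mul1r eq_sym; ring.
    by rewrite eq_sym (negbTE yh) !mul0r.
  by apply: sumr_ge0 => y _; exact: sqr_ge0.
have inv z : \sum_a rh a * chi a z = m%:R * r z.
  rewrite /rh; under eq_bigr do rewrite mulr_suml.
  rewrite exchange_big /= (bigD1 z) //= [X in _ + X]big1 => [|y yz].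
    rewrite addr0; under eq_bigr do rewrite -mulrA -chiDr addvv chi0 mulr1.
    by rewrite sumr_const mulr_natl.
  under eq_bigr do rewrite -mulrA -chiDr.
  rewrite -mulr_sumr sum_chi_delta.
  suff -> : (y + z == 0) = false by rewrite muln0 mulr0.
  by apply: contraNF yz => /eqP /(congr1 (+%R^~ z)); rewrite -addrA addvv addr0 add0r => ->.
have r0 : r 0 = m%:R.
  rewrite /r; under eq_bigr do rewrite addr0 eqxx.
  by rewrite sumr_const.
have rh0 : rh 0 = \sum_z r z.
  by apply: eq_bigr => z _; rewrite chiC chi0 mulr1.
have sumi a : a != 0 -> \sum_i chi a (g i) <= #|I|%:R - (2 * w)%:R.
  move=> /gen; rewrite -sum1_card => hw.
  have -> : \sum_i chi a (g i) = #|I|%:R - 2 * \sum_i (dot a (g i) != 0)%:R.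
    rewrite mulr_sumr -sum1_card natr_sum -sumrB; apply: eq_bigr => i _.
    by rewrite /chi; case: eqP.
  rewrite -natr_sum -natrM lerD2l lerN2 ler_nat leq_mul2l /=.
  apply: leq_trans hw _; rewrite big_mkcond /=; apply: leq_sum => i _.
  by rewrite inE; case: (_ != _).
(* After inversion the trivial character contributes [#|I| * rh 0], every other [a] at most
   [(#|I| - 2w) * rh a], and all [rh a] add up to [m * r 0 = m ^ 2]. *)
have key : m%:R * \sum_i r (g i) <=
    (#|I|%:R - (2 * w)%:R) * (m%:R * m%:R) + (2 * w)%:R * \sum_z r z.
  rewrite mulr_sumr; under eq_bigr do rewrite -inv.
  rewrite exchange_big /=.
  have -> : m%:R * m%:R = \sum_a rh a.
    by rewrite -{2}r0 -inv; apply: eq_bigr => a _; rewrite chi0 mulr1.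
  rewrite -rh0 (bigD1 0) //= [X in _ <= _ * X + _](bigD1 0) //=.
  rewrite [leRHS](_ : _ = #|I|%:R * rh 0 +
    (#|I|%:R - (2 * w)%:R) * \sum_(a | a != 0) rh a); last by ring.
  apply: lerD.
    under eq_bigr do rewrite chiC chi0 mulr1.
    by rewrite sumr_const mulr_natl.
  rewrite mulr_sumr.
  apply: ler_sum => a a0; rewrite -mulr_sumr mulrC.
  by apply: ler_wpM2r => //; exact: sumi.
have pr z : (\sum_h (psi h != psi (h + z)%R))%N%:R = m%:R - r z.
  rewrite /m -sum1_card !natr_sum /r -sumrB; apply: eq_bigr => h _.
  by case: eqP.
have pz : (\sum_h \sum_h' (psi h != psi h'))%N%:R = m%:R * m%:R - \sum_z r z.
  have -> : (\sum_h \sum_h' (psi h != psi h') = \sum_z \sum_h (psi h != psi (h + z)%R))%N.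
    rewrite [RHS]exchange_big /=; apply: eq_bigr => h _.
    by rewrite (reindex_inj (addrI h)).
  rewrite natr_sum; under eq_bigr do rewrite pr.
  by rewrite sumrB sumr_const -[X in X - _ = _]mulr_natl.
have pi : (\sum_i \sum_h (psi h != psi (h + g i)%R))%N%:R = #|I|%:R * m%:R - \sum_i r (g i).
  rewrite natr_sum; under eq_bigr do rewrite pr.
  by rewrite sumrB sumr_const -[X in X - _ = _]mulr_natl.
rewrite -(ler_nat int) !natrM pz pi.
rewrite natrM in key.
lra.
Qed.

(** A nonzero [a] is orthogonal to exactly half of all [z]. The weights 3 and 1 serve as an
    exponential moment in [good_code]. *)
Lemma card_dot (a : G) : a != 0 ->
  (\sum_z (if dot a z == 0%R then 3 else 1) = 2 * #|{: G}|)%N.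
Proof.
move=> /sum_chi h; apply/eqP; rewrite -(eqr_nat int) natrM natr_sum.
have -> : \sum_z (if dot a z == 0%R then 3 else 1)%N%:R = \sum_z (2 + chi a z).
  by apply: eq_bigr => z _; rewrite /chi; case: eqP.
by rewrite big_split /= h addr0 sumr_const mulr_natr.
Qed.

End Fourier.

(** Chernoff bound for random generators: a [g] that is bad for [a] has more than [7w] zero
    products, hence weight at least [3 ^ (7w)], while the mean weight is [2 ^ (8w)]. A union bound
    over the [2 ^ (2w)] vectors [a] follows. *)
Lemma good_code (w : nat) : (0 < w)%N ->
  exists g : {ffun 'I_(8 * w) -> 'rV['F_2]_(2 * w)},
  forall a, a != 0 -> (w <= #|[set i | dot a (g i) != 0%R]|)%N.
Proof.
move=> w0; set K := (8 * w)%N; set b := (2 * w)%N.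
pose bad (a : 'rV['F_2]_b) := [set g : {ffun 'I_K -> 'rV['F_2]_b} |
   (#|[set i | dot a (g i) != 0%R]| < w)%N].
set m := #|{: 'rV['F_2]_b}|.
have mE : m = (2 ^ b)%N by rewrite /m card_mx card_Fp // mul1n.
have bad_le a : a != 0 -> (#|bad a| * 3 ^ (7 * w) <= (2 * m) ^ K)%N.
  move=> a0.
  have -> : ((2 * m) ^ K = \sum_(g : {ffun 'I_K -> 'rV['F_2]_b})
      \prod_i (if dot a (g i) == 0%R then 3 else 1))%N.
    rewrite -(bigA_distr_bigA (fun _ z => if dot a z == 0%R then 3 else 1)%N) /=.
    by rewrite prod_nat_const card_ord (card_dot a0).
  rewrite -sum_nat_const big_mkcond /=; apply: leq_sum => g _.
  rewrite inE; case: ifP => // hg.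
  have -> : (\prod_i (if dot a (g i) == 0%R then 3 else 1) =
            3 ^ #|~: [set i | dot a (g i) != 0%R]|)%N.
    rewrite -big_mkcond /= prod_nat_const; congr (_ ^ _)%N.
    by apply: eq_card => i; rewrite !inE negbK.
  rewrite leq_exp2l // cardsCs setCK card_ord /K.
  by apply: leq_trans (leq_sub2l _ (ltnW hg)); lia.
have [/existsP[g /forallP hg]|] := boolP [exists g : {ffun 'I_K -> 'rV['F_2]_b},
   [forall a, (a != 0) ==> (w <= #|[set i | dot a (g i) != 0%R]|)%N]].
  by exists g => a a0; have := hg a; rewrite a0.
rewrite negb_exists => /forallP H; exfalso.
have cover : (m ^ K <= \sum_(a | a != 0%R) #|bad a|)%N.
  have -> : (m ^ K)%N = #|{: {ffun 'I_K -> 'rV['F_2]_b}}| by rewrite card_ffun card_ord.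
  apply: card_cover => g; have := H g; rewrite negb_forall => /existsP[a].
  by rewrite negb_imply -ltnNge => /andP[a0 hg]; exists a; rewrite // inE.
have : (m ^ K * 3 ^ (7 * w) <= m * (2 * m) ^ K)%N.
  apply: leq_trans (leq_mul cover (leqnn _)) _.
  rewrite big_distrl /=.
  apply: (@leq_trans (\sum_(a : 'rV['F_2]_b | a != 0%R) (2 * m) ^ K)%N).
    by apply: leq_sum => a; exact: bad_le.
  by rewrite sum_nat_const leq_mul2r max_card orbT.
(* Per unit of [w] this is [2 ^ 10 = 1024 < 2187 = 3 ^ 7]. *)
have lt37 : (m * 2 ^ K < 3 ^ (7 * w))%N.
  by rewrite mE -expnD /b /K -mulnDl !expnM ltn_exp2r.
have mK0 : (0 < m ^ K)%N by rewrite mE -expnM expn_gt0.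
rewrite expnMn mulnA [leqRHS]mulnC leq_pmul2l // leqNgt => /negP; apply.
exact: lt37.
Qed.

(** * Edge sets of large girth *)

Section Walks.
Variables (V : finType) (G : zmodType).
Implicit Types (F : {set V * V}) (s : V * V -> G).

(** Edges may be crossed both ways; [a] is the translation collected, so the walk lifts to one from
    [(x, h)] to [(y, h + a)] in the extension. *)
Inductive walk F s : nat -> V -> V -> G -> Prop :=
| walk_nil x : walk F s 0 x x 0
| walk_fwd l x e a : walk F s l x e.1 a -> e \in F -> walk F s l.+1 x e.2 (a + s e)
| walk_bwd l x e a : walk F s l x e.2 a -> e \in F -> walk F s l.+1 x e.1 (a - s e).

Lemma walk_trans F s l1 l2 x y z a1 a2 :
  walk F s l1 x y a1 -> walk F s l2 y z a2 -> walk F s (l1 + l2) x z (a1 + a2).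
Proof.
move=> w1 w2; elim: w2 w1 => {l2 y z a2} [y|l y e a _ IH eF|l y e a _ IH eF] w1.
- by rewrite addn0 addr0.
- by rewrite addnS addrA; apply: walk_fwd => //; exact: IH.
- by rewrite addnS addrA; apply: walk_bwd => //; exact: IH.
Qed.

Lemma walk_edge F s e : e \in F -> walk F s 1 e.1 e.2 (s e).
Proof. by move=> eF; rewrite -[s e]add0r; apply: walk_fwd => //; exact: walk_nil. Qed.

Lemma walk_edge_rev F s e : e \in F -> walk F s 1 e.2 e.1 (- s e).
Proof. by move=> eF; rewrite -[- s e]add0r; apply: walk_bwd => //; exact: walk_nil. Qed.

Lemma walk_sym F s l x y a : walk F s l x y a -> walk F s l y x (- a).
Proof.
elim=> {l x y a} [x|l x e a _ IH eF|l x e a _ IH eF].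
- by rewrite oppr0; exact: walk_nil.
- by rewrite opprD addrC -add1n; exact: walk_trans (walk_edge_rev _ eF) IH.
- by rewrite opprB -add1n; exact: walk_trans (walk_edge _ eF) IH.
Qed.

(* Girth larger than [r], in the form in which it is used. *)
Definition treelike r F := forall s l x a, walk F s l x x a -> (l <= r)%N -> a = 0.

Lemma treelike_set0 r : treelike r set0.
Proof.
suff H s l x y a : walk set0 s l x y a -> a = 0 by move=> s l x a /H.
by case=> // ? ? e ? _; rewrite inE.
Qed.

(* Between two successive uses of the new edge a short walk has to close up, so
   it can be shortened to a walk that uses the new edge at most once. *)
Lemma treelike_add r F e :
  treelike r F -> (forall s l a, (l <= r)%N -> ~ walk F s l e.1 e.2 a) ->
  treelike r (e |: F).
Proof.
move=> tF far s.
have far' l a : (l <= r)%N -> ~ walk F s l e.2 e.1 a by move=> lr /walk_sym; exact: far.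
suff H l x y a : walk (e |: F) s l x y a -> (l <= r)%N ->
   [\/ exists2 k, (k <= l)%N & walk F s k x y a,
       exists k1 k2 a1 a2, [/\ (k1 + k2 < l)%N, walk F s k1 x e.1 a1,
         walk F s k2 e.2 y a2 & a = a1 + s e + a2] |
       exists k1 k2 a1 a2, [/\ (k1 + k2 < l)%N, walk F s k1 x e.2 a1,
         walk F s k2 e.1 y a2 & a = a1 - s e + a2]].
  move=> l x a /H{}H lr; case: (H lr) => [[k kl /tF]|[k1[k2[a1[a2[kl w1 w2 _]]]]]|[k1[k2[a1[a2[kl w1 w2 _]]]]]].
  - by apply; exact: leq_trans lr.
  - by case: (far' _ _ _ (walk_trans w2 w1)); lia.
  - by case: (far _ _ _ _ (walk_trans w2 w1)); lia.
elim=> {l x y a} [x _|l x f a _ IH|l x f a _ IH].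
- by constructor 1; exists 0%N => //; exact: walk_nil.
- move=> fF lr; case: (IH (ltnW lr)) => [[k kl w]|[k1[k2[a1[a2[kl w1 w2 ->]]]]]|[k1[k2[a1[a2[kl w1 w2 ->]]]]]];
  move: fF; rewrite in_setU1 => /orP[/eqP fE|fF]; subst.
  + constructor 2; exists k, 0%N, a, 0; split; rewrite ?addn0 ?addr0 //; exact: walk_nil.
  + constructor 1; exists k.+1 => //; exact: walk_fwd.
  + by case: (far' _ _ _ w2); lia.
  + constructor 2; exists k1, k2.+1, a1, (a2 + s f); split; rewrite ?addrA //; first lia.
    exact: walk_fwd.
  + constructor 1; exists k1; first lia.
    by rewrite (tF _ _ _ _ w2) ?addr0 ?subrK //; lia.
  + constructor 3; exists k1, k2.+1, a1, (a2 + s f); split; rewrite ?addrA //; first lia.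
    exact: walk_fwd.
- move=> fF lr; case: (IH (ltnW lr)) => [[k kl w]|[k1[k2[a1[a2[kl w1 w2 ->]]]]]|[k1[k2[a1[a2[kl w1 w2 ->]]]]]];
  move: fF; rewrite in_setU1 => /orP[/eqP fE|fF]; subst.
  + constructor 3; exists k, 0%N, a, 0; split; rewrite ?addn0 ?addr0 //; exact: walk_nil.
  + constructor 1; exists k.+1 => //; exact: walk_bwd.
  + constructor 1; exists k1; first lia.
    by rewrite (tF _ _ _ _ w2) ?addr0 ?addrK //; lia.
  + constructor 2; exists k1, k2.+1, a1, (a2 - s f); split; rewrite ?addrA //; first lia.
    exact: walk_bwd.
  + by case: (far _ _ _ _ w2); lia.
  + constructor 3; exists k1, k2.+1, a1, (a2 - s f); split; rewrite ?addrA //; first lia.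
    exact: walk_bwd.
Qed.

Definition deg F x := (#|[set e in F | e.1 == x]| + #|[set e in F | e.2 == x]|)%N.

Lemma sum_deg F (f : V -> nat) :
  (\sum_(e in F) (f e.1 + f e.2) = \sum_x deg F x * f x)%N.
Proof.
rewrite big_split /=; under [RHS]eq_bigr do rewrite mulnDl.
rewrite big_split /=.
have H (p : V * V -> V) : (\sum_(e in F) f (p e) = \sum_x #|[set e in F | p e == x]| * f x)%N.
  rewrite (partition_big p xpredT) //=; apply: eq_bigr => x _.
  rewrite -sum_nat_const [RHS](eq_bigl (fun e => (e \in F) && (p e == x))); last by move=> e; rewrite inE.
  by apply: eq_bigr => e /andP[_ /eqP ->].
by rewrite (H fst) (H snd).
Qed.

Lemma deg_add F e x : (deg (e |: F) x <= deg F x + (e.1 == x) + (e.2 == x))%N.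
Proof.
have H (p : V * V -> V) :
   (#|[set f in e |: F | p f == x]| <= #|[set f in F | p f == x]| + (p e == x))%N.
  have [pe|pe] := eqVneq (p e) x.
    rewrite /= addnC -(cards1 e); apply: leq_trans (leq_of_leqif (leq_card_setU _ _)).
    apply: subset_leq_card; apply/subsetP => f; rewrite !inE.
    by case: (f == e).
  rewrite addn0; apply: subset_leq_card; apply/subsetP => f; rewrite !inE.
  by case: (f =P e) => [->|//] /=; rewrite (negbTE pe).
rewrite /deg; have := H fst; have := H snd; lia.
Qed.

Lemma walk_last F s l x y a : walk F s l x y a ->
  x = y \/ exists e l' a', [/\ e \in F, (l' < l)%N &
    y = e.2 /\ walk F s l' x e.1 a' \/ y = e.1 /\ walk F s l' x e.2 a'].
Proof.
case=> {l x y a} [x|l x e a w eF|l x e a w eF]; first by left.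
- by right; exists e, l, a; split => //; left.
- by right; exists e, l, a; split => //; right.
Qed.

(** Each unit of radius adds at most [d] neighbours per point of the ball, hence a factor [d.+1]. *)
Lemma ball_bound F d r x0 : (forall x, deg F x <= d)%N ->
  (#|[set y | `[< exists s l a, (l <= r)%N /\ walk F s l x0 y a >]]| <= d.+1 ^ r)%N.
Proof.
move=> dF; elim: r => [|r IH].
  rewrite expn0 -(cards1 x0); apply: subset_leq_card; apply/subsetP => y.
  rewrite !inE => /asboolP[s[l[a[]]]]; rewrite leqn0 => /eqP ->.
  by move=> w; inversion w.
set B := [set y | _] in IH; set B' := [set y | _].
have sub : B' \subset B :|: \bigcup_(x in B) ([set e.2 | e in [set e in F | e.1 == x]] :|:
                                   [set e.1 | e in [set e in F | e.2 == x]]).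
  apply/subsetP => y; rewrite inE => /asboolP[s[l[a[lr w]]]].
  rewrite inE; case: (walk_last w) => [<-|[e [k [c [eF kl [[-> {}w]|[-> {}w]]]]]]]; apply/orP.
  - by left; rewrite inE; apply/asboolP; exists s, 0%N, 0; split => //; exact: walk_nil.
  - right; apply/bigcupP; exists e.1.
      by rewrite inE; apply/asboolP; exists s, k, c; split => //; lia.
    by rewrite inE; apply/orP; left; apply/imsetP; exists e; rewrite ?inE ?eF /=.
  - right; apply/bigcupP; exists e.2.
      by rewrite inE; apply/asboolP; exists s, k, c; split => //; lia.
    by rewrite inE; apply/orP; right; apply/imsetP; exists e; rewrite ?inE ?eF /=.
apply: leq_trans (subset_leq_card sub) _.
apply: leq_trans (leq_of_leqif (leq_card_setU _ _)) _.
suff H : (#|\bigcup_(x in B) ([set e.2 | e in [set e in F | e.1 == x]] :|: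
                                   [set e.1 | e in [set e in F | e.2 == x]])| <= #|B| * d)%N.
  by rewrite expnS mulSn mulnC; apply: leq_add => //; apply: leq_trans H _; rewrite leq_mul2r IH orbT.
rewrite -sum_nat_const; elim/big_rec2: _ => [|x n S xB IHn]; first by rewrite cards0.
apply: leq_trans (leq_of_leqif (leq_card_setU _ _)) _; apply: leq_add => //.
apply: leq_trans (leq_of_leqif (leq_card_setU _ _)) _; apply: leq_trans (dF x).
by apply: leq_add; exact: leq_imset_card.
Qed.

(* In a maximal tree-like edge set of maximum degree at most [d], any two
   vertices of smaller degree are joined by a walk of length at most [r]. *)
Lemma exists_treelike d r : (0 < r)%N -> (2 * d.+1 ^ r <= #|V|)%N ->
  exists F, [/\ treelike r F, (forall x, deg F x <= d)%N & (d * #|V| <= 4 * #|F|)%N].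
Proof.
move=> r0 hV.
pose P (F : {set V * V}) := `[< treelike r F /\ forall x, (deg F x <= d)%N >].
have P0 : P set0.
  apply/asboolP; split => [|x]; first exact: treelike_set0.
  have H (p : V * V -> V) : #|[set e in finset.set0 | p e == x]| = 0%N.
    by apply: eq_card0 => e; rewrite !inE.
  by rewrite /deg (H fst) (H snd).
case: (@arg_maxnP _ set0 P (fun F => #|F|) P0) => F /asboolP[tF dF] maxF.
exists F; split => //.
pose D := [set x | (deg F x < d)%N].
have cD : (#|D| <= d.+1 ^ r)%N.
  have [->|[x0 x0D]] := set_0Vmem D; first by rewrite cards0.
  apply: leq_trans (ball_bound r x0 dF); apply: subset_leq_card; apply/subsetP => y yD.
  rewrite inE; apply/asboolP; apply: contrapT => far.
  have [x0y|x0y] := eqVneq x0 y.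
    by apply: far; exists (fun=> 0), 0%N, 0; split => //; rewrite x0y; exact: walk_nil.
  have eF : (x0, y) \notin F.
    apply/negP => eF; apply: far; exists (fun=> 0), 1%N, 0; split => //.
    exact: (walk_edge (fun=> 0) eF).
  have : P ((x0, y) |: F).
    apply/asboolP; split.
      by apply: treelike_add => // s l a lr w; apply: far; exists s, l, a.
    move=> x; apply: leq_trans (deg_add _ _ _) _ => /=.
    move: x0D yD (dF x); rewrite !inE.
    have [<-|] := eqVneq x0 x; first by rewrite eq_sym (negbTE x0y); lia.
    by have [<-|] := eqVneq y x; lia.
  by move/maxF; rewrite cardsU1 eF /=; lia.
(* Vertices outside [D] have full degree, and they are at least half of all since
   [2 * #|D| <= 2 * d.+1 ^ r <= #|V|]. *)
have : (d * #|~: D| <= 2 * #|F|)%N.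
  have <- : (\sum_x deg F x * 1 = 2 * #|F|)%N.
    by rewrite -(sum_deg F (fun=> 1%N)) sum_nat_const mulnC.
  rewrite mulnC -sum_nat_const big_mkcond /=; apply: leq_sum => x _.
  by rewrite !inE -leqNgt muln1; case: ifP.
have := cardsC D; nia.
Qed.

End Walks.

(** * Random translations along the edges *)

(** Expanding [(1 + s) ^ #|I|] over subsets gives each [A] the weight [s ^ #|~: A|], which is large
    for small [A]. The factor [s ^ t] avoids a subtraction. *)
Lemma card_small_subsets (I : finType) (t s : nat) : (0 < s)%N ->
  (#|[set A : {set I} | (#|A| <= t)%N]| * s ^ #|I| <= s ^ t * s.+1 ^ #|I|)%N.
Proof.
move=> s0.
have -> : (s.+1 ^ #|I| = \sum_(A : {set I}) s ^ #|~: A|)%N.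
  transitivity (\prod_(i : I) (1 + s))%N; first by rewrite prod_nat_const add1n.
  rewrite (bigA_distr _ _ (fun=> 1%N) (fun=> s)) /=; apply: eq_bigr => A _.
  rewrite -prod_nat_const [RHS]big_mkcond /=; apply: eq_bigr => i _.
  by rewrite inE; case: ifP.
rewrite -sum_nat_const big_distrr /= big_mkcond /=; apply: leq_sum => A _.
rewrite inE; case: ifP => // hA.
by rewrite -(cardsC A) expnD leq_mul2r leq_pexp2l ?orbT.
Qed.

(** Bernoulli's inequality [(1 - 1/(s+1)) ^ j >= 1 - j/(s+1)] with denominators cleared. *)
Lemma bernoulli_bound (s j : nat) : (s.+1 ^ j * (s.+1 - j) <= s ^ j * s.+1)%N.
Proof.
elim: j => [|j IH]; first by rewrite !expn0 subn0.
have : (s.+1 * (s.+1 - j.+1) <= s * (s.+1 - j))%N.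
  have [|/ltnW] := leqP j.+1 s.+1; last by rewrite -subn_eq0 => /eqP ->; rewrite muln0.
  nia.
rewrite !expnS; move: IH; set x := (s.+1 ^ j)%N; set y := (s ^ j)%N.
move: (s.+1 - j)%N (s.+1 - j.+1)%N => c d IH h.
apply: (@leq_trans (x * (s * c))%N).
  by rewrite -mulnA mulnCA leq_mul2l h orbT.
by rewrite mulnCA -mulnA leq_mul2l IH orbT.
Qed.

(** Take [s = 2j] in [card_small_subsets]: by Bernoulli [(1 + 1/(2j)) ^ j <= 2], and the power [8Q]
    of this is needed. *)
Lemma card_ball (I : finType) (j Q : nat) : (0 < j)%N -> #|I| = (8 * (j * Q))%N ->
  (#|[set A : {set I} | (#|A| <= Q)%N]| <= (2 * j) ^ Q * 2 ^ (8 * Q))%N.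
Proof.
move=> j0 cI; have s0 : (0 < 2 * j)%N by lia.
have h : ((2 * j).+1 ^ j <= 2 * (2 * j) ^ j)%N.
  have := bernoulli_bound (2 * j) j; move: (_ ^ j)%N (_ ^ j)%N => x y.
  rewrite (_ : (2 * j).+1 - j = j.+1)%N; last by lia.
  by nia.
have := @card_small_subsets I Q _ s0; rewrite cI => H.
rewrite -(leq_pmul2r (_ : 0 < (2 * j) ^ (8 * (j * Q)))%N) ?expn_gt0 ?s0 //.
apply: leq_trans H _; rewrite -[leqRHS]mulnA leq_mul2l; apply/orP; right.
rewrite (_ : 8 * (j * Q) = j * (8 * Q))%N; last by lia.
rewrite !(expnM _ j) -expnMn.
by move: (8 * Q)%N => [//|k]; rewrite leq_exp2r.
Qed.

(* For fixed [u] and [E] at most a [#|B| / #|G|] fraction of the labels is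
   compatible with an edge of [E]; the vertices contribute too few choices of
   [u] to compensate. *)
Lemma exists_label (V : finType) (G : finZmodType) (F : {set V * V}) (B : {set G}) (Q : nat) :
  (0 < Q)%N -> (0 < #|V|)%N -> (2 * #|V| <= #|F|)%N ->
  #|{: G}| = (2 ^ (128 * Q))%N -> (#|B| <= 2 ^ (15 * Q))%N ->
  exists s : {ffun V * V -> G}, forall (u : V -> G) (E : {set V * V}),
    E \subset F -> (7 * #|F| <= 8 * #|E|)%N ->
    exists2 e, e \in E & u e.1 + s e - u e.2 \notin B.
Proof.
move=> Q0 V0 hF cG cB.
pose bad (p : {ffun V -> G} * {set V * V}) := [set s : {ffun V * V -> G} |
   [forall (e | e \in p.2), p.1 e.1 + s e - p.1 e.2 \in B]].
pose P (p : {ffun V -> G} * {set V * V}) := (p.2 \subset F) && (7 * #|F| <= 8 * #|p.2|)%N.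
set m := #|{: G}| in cG.
set N := #|{: V * V}|.
have bad_le p : P p -> (#|bad p| * 2 ^ (98 * Q * #|F|) <= m ^ N)%N.
  case: p => u E /andP[/= EF cE].
  (* Compatibility confines [s e] to a translate of [B] for [e] in [E]; all other labels are
     free. *)
  pose A (e : V * V) : {set G} := if e \in E then (fun x => - u e.1 + x + u e.2) @: B else [set: G].
  have : (#|bad (u, E)| <= #|family (fun e => mem (A e))|)%N.
    apply: subset_leq_card; apply/subsetP => s; rewrite inE => /forallP H.
    apply/familyP => e; rewrite /A; have := H e => /=.
    case: ifP => [eE|_ _] /=; last by rewrite !inE.
    move=> h; apply/imsetP; exists (u e.1 + s e - u e.2) => //.
    rewrite /=. by rewrite !addrA addNr add0r subrK.
  rewrite card_family foldrE big_map big_enum /= => H.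
  have {}H : (#|bad (u, E)| <= 2 ^ (15 * Q * #|E|) * m ^ #|~: E|)%N.
    apply: leq_trans H _; rewrite (bigID (mem E)) /=; apply: leq_mul.
      rewrite expnM -prod_nat_const; apply: leq_prod => e eE.
      by rewrite /A eE; apply: leq_trans (leq_imset_card _ _) cB.
    rewrite -prod_nat_const [leqRHS](eq_bigl (fun e => e \notin E)); last by move=> e; rewrite inE.
    by apply: leq_prod => e eE; rewrite /A (negbTE eE) cardsT.
  apply: leq_trans (leq_mul H (leqnn _)) _.
  have cN : N = (#|E| + #|~: E|)%N by rewrite cardsC.
  rewrite mulnAC -expnD cN [in leqRHS]expnD leq_mul2r; apply/orP; right.
  (* Each edge of [E] saves a factor [2 ^ (128Q - 15Q)], and [113 * 7/8 > 98]. *)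
  suff ar Q' f k : (7 * f <= 8 * k -> 15 * Q' * k + 98 * Q' * f <= 128 * Q' * k)%N.
    by rewrite cG -expnM leq_exp2l //; exact: ar cE.
  by move=> h; have := leq_mul (leqnn Q') h; lia.
have [/existsP[s /forallP Hs]|] := boolP [exists s, [forall p, P p ==> (s \notin bad p)]].
  exists s => u E EF cE; have := Hs ([ffun x => u x], E); rewrite /P /= EF cE inE /=.
  rewrite negb_forall => /existsP[e]; rewrite negb_imply !ffunE => /andP[eE h].
  by exists e.
rewrite negb_exists => /forallP H; exfalso.
have cover : (m ^ N <= \sum_(p | P p) #|bad p|)%N.
  have -> : (m ^ N)%N = #|{: {ffun V * V -> G}}| by rewrite card_ffun.
  apply: card_cover => s; have := H s; rewrite negb_forall => /existsP[p].
  by rewrite negb_imply negbK => /andP[Pp hs]; exists p.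
have cP : (#|[set p | P p]| <= m ^ #|V| * 2 ^ #|F|)%N.
  rewrite -card_ffun -card_powerset -cardsT -cardsX; apply: subset_leq_card.
  by apply/subsetP => -[u E]; rewrite !inE => /andP[].
have : (m ^ N * 2 ^ (98 * Q * #|F|) <= m ^ N * (m ^ #|V| * 2 ^ #|F|))%N.
  apply: leq_trans (leq_mul cover (leqnn _)) _.
  rewrite big_distrl /=.
  apply: (@leq_trans (\sum_(p | P p) m ^ N)%N); first by apply: leq_sum => p; exact: bad_le.
  by rewrite sum_nat_const mulnC leq_mul2l -[X in (X <= _)%N]cardsE cP orbT.
rewrite leq_pmul2l; last by rewrite cG -expnM expn_gt0.
rewrite cG -expnM -expnD leq_exp2l //.
(* At most [2 ^ (128Q#|V| + #|F|) <= 2 ^ (65Q#|F|)] choices of [(u, E)] face a saving of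
   [2 ^ (98Q#|F|)]. *)
have : (0 < Q * #|F|)%N by rewrite muln_gt0 Q0; apply: leq_trans hF; rewrite muln_gt0.
have := leq_mul (leqnn Q) hF; have := leq_pmull #|F| Q0.
move: #|V| #|F| => n f; clear; lia.
Qed.

(** * The extension and its sections *)

Section Extension.
Variables (V : finType) (G : finZmodType) (F : {set V * V}) (s : V * V -> G).
Variables (I : finType) (g : I -> G) (q M : nat).
Hypothesis addxx : forall x : G, x + x = 0.
Local Notation X := (V * G)%type.

(** A path of cost at most [c]: as [G] is commutative, translations along base edges and generator
    steps can be collected separately. *)
Definition link c (x y : X) := exists l a (S : seq I),
  [/\ walk F s l x.1 y.1 a, y.2 = x.2 + a + \sum_(i <- S) g i &
      (q * l + size S <= c)%N].

Lemma oppxx (x : G) : - x = x.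
Proof. by apply/eqP; rewrite eq_sym -addr_eq0 addxx. Qed.

Lemma link_mono c c' x y : (c <= c')%N -> link c x y -> link c' x y.
Proof.
by move=> cc [l[a[S[w e h]]]]; exists l, a, S; split => //; exact: leq_trans cc.
Qed.

Lemma link_refl x : link 0 x x.
Proof.
exists 0%N, 0, [::]; split; rewrite ?muln0 //; first exact: walk_nil.
by rewrite big_nil !addr0.
Qed.

Lemma link_sym c x y : link c x y -> link c y x.
Proof.
move=> [l[a[S[w e h]]]]; exists l, (- a), S; split => //; first exact: walk_sym.
by rewrite e [X in X - _]addrAC addrK -addrA addxx addr0.
Qed.

Lemma link_trans c c' x y z : link c x y -> link c' y z -> link (c + c') x z.
Proof.
move=> [l[a[S[w e h]]]] [l'[a'[S'[w' e' h']]]].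
exists (l + l')%N, (a + a'), (S ++ S'); split; first exact: walk_trans w w'.
  by rewrite e' e big_cat /= !addrA; congr (_ + _); rewrite -!addrA; do 2 congr (_ + _); rewrite addrC.
by rewrite size_cat mulnDr addnACA leq_add.
Qed.

Lemma dist_ex x y : exists c, (c == M) || `[< link c x y >].
Proof. by exists M; rewrite eqxx. Qed.

(* The shortest path metric with fibre edges of length [1] and base edges of
   length [q], truncated at [M] because the base may be disconnected. *)
Definition dist x y := ex_minn (dist_ex x y).

Lemma dist_le x y c : link c x y -> (dist x y <= c)%N.
Proof.
rewrite /dist; case: ex_minnP => c0 _ H h; apply: H.
by apply/orP; right; apply/asboolP.
Qed.

Lemma dist_leM x y : (dist x y <= M)%N.
Proof. by rewrite /dist; case: ex_minnP => c0 _ H; apply: H; rewrite eqxx. Qed.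

Lemma dist_link x y c : (dist x y <= c)%N -> (c < M)%N -> link c x y.
Proof.
rewrite /dist; case: ex_minnP => c0 /orP[/eqP -> _ h1 h2|/asboolP h _ h1 _].
  by move: h2; rewrite ltnNge h1.
exact: link_mono h1 h.
Qed.

Lemma dist_xx x : dist x x = 0%N.
Proof. by apply/eqP; rewrite -leqn0; apply: dist_le; exact: link_refl. Qed.

Lemma dist_sym x y : dist x y = dist y x.
Proof.
suff H x' y' : (dist x' y' <= dist y' x')%N by apply/eqP; rewrite eqn_leq !H.
have [h|h] := ltnP (dist y' x') M; last exact: leq_trans (dist_leM _ _) h.
by apply/dist_le/link_sym/dist_link.
Qed.

Lemma dist_triangle x y z : (dist x z <= dist x y + dist y z)%N.
Proof.
have [h|h] := ltnP (dist x y) M; last first.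
  by apply: leq_trans (dist_leM _ _) _; exact: leq_trans (leq_addr _ _).
have [h'|h'] := ltnP (dist y z) M; last first.
  by apply: leq_trans (dist_leM _ _) _; exact: leq_trans (leq_addl _ _).
by apply/dist_le/link_trans; exact: dist_link.
Qed.

Lemma dist_fibre v h i : (dist (v, h) (v, h + g i)%R <= 1)%N.
Proof.
apply: dist_le; exists 0%N, 0, [:: i]; split; rewrite /= ?muln0 //; first exact: walk_nil.
by rewrite big_seq1 addr0.
Qed.

Lemma dist_base e h : e \in F -> (dist (e.1, h) (e.2, h + s e)%R <= q)%N.
Proof.
move=> eF; apply: dist_le; exists 1%N, (s e), [::]; split; rewrite /= ?muln1 ?addn0 //.
  exact: walk_edge.
by rewrite big_nil addr0.
Qed.

(** In exponent 2 repeated generators cancel in pairs. This leads to the small subsets counted by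
    [card_ball]. *)
Lemma sum_seq_set (S : seq I) :
  exists2 A : {set I}, (#|A| <= size S)%N & \sum_(i <- S) g i = \sum_(i in A) g i.
Proof.
elim: S => [|i S [A cA E]].
  by exists finset.set0; rewrite ?cards0 // big_nil big_set0.
rewrite big_cons E; have [iA|iA] := boolP (i \in A).
  exists (A :\ i); first by rewrite /=; have := cardsD1 i A; lia.
  by rewrite (big_setD1 _ iA) /= addrA addxx add0r.
by exists (i |: A); rewrite ?cardsU1 ?iA ?big_setU1 //=; lia.
Qed.

Hypothesis q0 : (0 < q)%N.
Hypothesis hM : (q ^ 4 < M)%N.
Hypothesis treeF : treelike G (4 * q ^ 3) F.
Hypothesis degF : forall x, (deg F x <= 8)%N.
Hypothesis cardF : (2 * #|V| <= #|F|)%N.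
Hypothesis label : forall (u : V -> G) (E : {set V * V}),
  E \subset F -> (7 * #|F| <= 8 * #|E|)%N ->
  exists2 e, e \in E & u e.1 + s e - u e.2 \notin
    (fun A : {set I} => \sum_(i in A) g i) @: [set A : {set I} | (#|A| <= q ^ 3)%N].

(** * Lower bound for an arbitrary map of the extension *)

Section Map.
Variable phi : X -> X.

(** With displacements weighted [1/q^2] and base edges [1/q], exceeding either threshold costs more
    than [q^2]. [cut] compares equal [h] in both fibres, not the matched [h] and [h + s e]. *)
Definition far v h := (q ^ 4 < dist (v, h) (phi (v, h)))%N.
Definition cut e h := (q ^ 3 < dist (phi (e.1, h)) (phi (e.2, h)))%N.

(* Following the displacement of [phi (v, h)] back to the fibre of [v] turns
   [v |-> phi (v, h)] into a section [u]; as the closed walks involved are short,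
   [u] is almost continuous along every good edge. *)
Lemma many_bad_edges h :
  (#|V| <= 4 * \sum_(e in F) (cut e h + (far e.1 h + far e.2 h)))%N.
Proof.
(* [u v] is [phi (v, h)] carried back along the base walk, that is [h] plus the fibre generators; 0
   is a default for far [v]. *)
have /choice[u Hu] v : exists x : G, ~~ far v h ->
    exists2 l, (l <= q ^ 3)%N & walk F s l v (phi (v, h)).1 ((phi (v, h)).2 - x).
  have [_|nfar] := boolP (far v h); first by exists 0.
  move: nfar; rewrite /far -leqNgt => /dist_link /(_ hM) [l[a[S[w e hl]]]].
  exists (h + \sum_(i <- S) g i) => _; exists l; last first.
    rewrite e /= [_ - _](_ : _ = a) //.
    by apply/eqP; rewrite subr_eq addrA [a + h]addrC.
  by rewrite -(leq_pmul2l q0) -expnS; apply: leq_trans hl; exact: leq_addr.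
pose bad e := [|| cut e h, far e.1 h | far e.2 h].
pose E := [set e in F | ~~ bad e].
have cE : (8 * #|E| < 7 * #|F|)%N.
  rewrite ltnNge; apply/negP => /(label u).
  case=> [|e]; first by apply/subsetP => e; rewrite inE => /andP[].
  rewrite inE !negb_or => /andP[eF /and3P[ncut /Hu[l1 hl1 w1] /Hu[l2 hl2 w2]]] /negP; apply.
  have /dist_link[|l [a [S [w hS hl]]]] : (dist (phi (e.1, h)) (phi (e.2, h)) <= q ^ 3)%N.
  - by rewrite leqNgt.
  - by apply: leq_ltn_trans hM; rewrite leq_pexp2l.
  have [A cA EA] := sum_seq_set S.
  apply/imsetP; exists A; first by rewrite inE (leq_trans cA) // (leq_trans _ hl) // leq_addl.
  have lq : (l <= q ^ 2)%N.
    by rewrite -(leq_pmul2l q0) -expnS; apply: leq_trans hl; exact: leq_addr.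
  have lq3 : (q ^ 2 <= q ^ 3)%N by rewrite leq_pexp2l.
  have q30 : (0 < q ^ 3)%N by rewrite expn_gt0 q0.
  (* The closed base walk through [e.1], the projections of [phi (e.1, h)] and [phi (e.2, h)], and
     [e.2] has length at most [2q^3 + q^2 + 1 <= 4q^3], so its labels cancel and only the sum over
     [A] remains. *)
  have := walk_trans (walk_trans (walk_trans w1 w) (walk_sym w2)) (walk_edge_rev s eF).
  move/treeF => /(_ ltac:(lia)); rewrite -EA hS => /eqP.
  rewrite subr_eq add0r => /eqP <-.
  move: (u e.1) (u e.2) (phi _).2 (\sum_(i <- S) g i) => x y z t.
  rewrite opprB [z - x + a]addrAC; move: (z + a) => {}z.
  rewrite [x + _]addrC [_ + x]addrAC subrK addrCA [y + _]addrC addrK.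
  by rewrite opprD addrA subrr add0r oppxx.
have cbad : (#|F :\: E| <= \sum_(e in F) (cut e h + (far e.1 h + far e.2 h)))%N.
  rewrite -sum1_card big_mkcond [leqRHS]big_mkcond /=; apply: leq_sum => e _.
  rewrite !inE /bad; case: (e \in F) => //=; rewrite ?andbF //.
  by case: (cut e h); case: (far e.1 h); case: (far e.2 h).
have EF : E \subset F by apply/subsetP => e; rewrite inE => /andP[].
(* More than [#|F| / 8] edges are bad, and [#|F| >= 2 * #|V|]. *)
have := cardsD F E; rewrite (setIidPr EF) => c2.
move: cE cardF cbad; rewrite c2; move: #|F| #|E| (\sum_(e in F) _)%N #|V|; clear; lia.
Qed.

Definition fibre_defect v := (\sum_h \sum_h' (phi (v, h) != phi (v, h')))%N.

(** Compare with every [h']: if [phi] agrees at [h] and [h'] over [e.1], and at [h] and [h' + s e]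
    over [e.2], a cut at [h] stretches the matched edge at [h'] beyond [q^3]. Otherwise a fibre
    defect pays. *)
Lemma cut_bound e : (#|G| * \sum_h q ^ 3 * cut e h <=
  q ^ 3 * (fibre_defect e.1 + fibre_defect e.2) +
  #|G| * \sum_h dist (phi (e.1, h)) (phi (e.2, h + s e)%R))%N.
Proof.
rewrite mulnDr /fibre_defect.
have -> : (\sum_h \sum_h' (phi (e.2, h) != phi (e.2, h')) =
           \sum_h \sum_h' (phi (e.2, h) != phi (e.2, h' + s e)%R))%N.
  by apply: eq_bigr => h _; exact: (reindex_inj (addIr (s e))).
rewrite -[X in (_ + X)%N]sum_nat_const !big_distrr /= -!big_split /=; apply: leq_sum => h _.
rewrite -sum_nat_const !big_distrr /= -!big_split /=; apply: leq_sum => h' _.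
have mulb_le (Q d : nat) : (Q * (Q < d) <= d)%N.
  by case: ltnP => [/ltnW|]; rewrite ?muln1 ?muln0.
have mul_le1 (Q : nat) (c : bool) : (Q * c <= Q)%N by rewrite -{2}[Q]muln1 leq_mul2l leq_b1 orbT.
rewrite /cut; case: eqP => [->|_] /=.
  case: eqP => [->|_] /=; first by rewrite muln0 !add0n mulb_le.
  by rewrite muln0 muln1 add0n; apply: leq_trans (mul_le1 _ _) (leq_addr _ _).
by rewrite muln1 -addnA; apply: leq_trans (mul_le1 _ _) (leq_addr _ _).
Qed.

(** Sum [many_bad_edges] over [h], charging cuts by [cut_bound] and far points by Markov's
    inequality; the degree bound turns edge sums into vertex sums. *)
Lemma total_bound :
  (q ^ 4 * #|V| * #|G| * #|G| <= 4 * (8 * q ^ 4 * \sum_v fibre_defect v +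
     q * #|G| * (\sum_(e in F) \sum_h dist (phi (e.1, h)) (phi (e.2, h + s e)%R)) +
     8 * #|G| * \sum_v \sum_h dist (v, h) (phi (v, h))))%N.
Proof.
have H1 : (#|V| * #|G| <= 4 * \sum_h \sum_(e in F) (cut e h + (far e.1 h + far e.2 h)))%N.
  by rewrite mulnC -sum_nat_const big_distrr; apply: leq_sum => h _; exact: many_bad_edges.
pose C := (\sum_(e in F) \sum_h cut e h)%N.
pose D := (\sum_v \sum_h far v h)%N.
have H2 : (\sum_h \sum_(e in F) (cut e h + (far e.1 h + far e.2 h)) <= C + 8 * D)%N.
  rewrite exchange_big /=; under eq_bigr do rewrite !big_split /=.
  rewrite big_split /= leq_add2l (sum_deg F (fun v => \sum_h far v h)%N) big_distrr /=.
  by apply: leq_sum => v _; rewrite leq_mul2r degF orbT.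
have H3 : (q ^ 4 * D <= \sum_v \sum_h dist (v, h) (phi (v, h)))%N.
  rewrite big_distrr /=; apply: leq_sum => v _; rewrite big_distrr /=; apply: leq_sum => h _.
  by rewrite /far; case: ltnP => /=; lia.
have H4 : (#|G| * (q ^ 3 * C) <= q ^ 3 * (8 * \sum_v fibre_defect v) +
    #|G| * \sum_(e in F) \sum_h dist (phi (e.1, h)) (phi (e.2, h + s e)%R))%N.
  apply: (@leq_trans (\sum_(e in F) (q ^ 3 * (fibre_defect e.1 + fibre_defect e.2) +
     #|G| * \sum_h dist (phi (e.1, h)) (phi (e.2, h + s e)%R)))%N).
    rewrite !big_distrr /=; apply: leq_sum => e _.
    by apply: leq_trans (cut_bound e); rewrite big_distrr.
  rewrite big_split /= -!big_distrr /= leq_add2r leq_mul2l; apply/orP; right.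
  rewrite sum_deg big_distrr /=.
  by apply: leq_sum => v _; rewrite leq_mul2r degF orbT.
move: H1 H2 H3 H4.
move: (\sum_h _)%N (\sum_(e in F) \sum_h dist _ _)%N (\sum_v \sum_h _)%N (\sum_v _)%N => S1 A2 A3 A1.
rewrite (expnS q 3).
move: (q ^ 3)%N #|G| #|V| => Q m n H1 H2 H3 H4.
have E1 : (n * m <= 4 * (C + 8 * D))%N by lia.
apply: (@leq_trans (q * m * (4 * (Q * C) + 32 * (Q * D)))%N).
  have := leq_mul (leqnn (q * Q * m)%N) E1; nia.
have := leq_mul (leqnn q) H4; have := leq_mul (leqnn m) H3; nia.
Qed.

End Map.
End Extension.

(** * The gap instance *)

Section Multigraph.
Variables (R : realType) (W J : finType) (p r : J -> W) (c : J -> R).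

(** Indexing edges by [J] allows parallel edges, whose weights add up, and loops, which cost
    nothing. The two orientations cancel the 1/2 in [cost]. *)
Definition multi_weight u v : R :=
  \sum_j c j * (((u == p j) && (v == r j))%:R + ((u == r j) && (v == p j))%:R).

Lemma multi_weight_sym u v : multi_weight u v = multi_weight v u.
Proof.
by apply: eq_bigr => j _; rewrite addrC [(v == _) && _]andbC [(v == _) && _]andbC.
Qed.

Lemma sum_multi_weight (d : W -> W -> R) :
  (forall u, d u u = 0) -> (forall u v, d u v = d v u) ->
  2^-1 * \sum_u \sum_(v | u != v) multi_weight u v * d u v =
  \sum_j c j * d (p j) (r j).
Proof.
move=> d0 dC.
have E u : \sum_(v | u != v) multi_weight u v * d u v = \sum_v multi_weight u v * d u v.
  rewrite [RHS](bigID (fun v => u != v)) /= [X in _ + X]big1 ?addr0 // => v.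
  by rewrite negbK => /eqP ->; rewrite d0 mulr0.
under eq_bigr do rewrite E.
have D (a b : W) : \sum_u \sum_v ((u == a) && (v == b))%:R * d u v = d a b.
  rewrite (bigD1 a) //= [X in _ + X]big1 => [|u ua]; last first.
    by rewrite big1 // => v _; rewrite (negbTE ua) mul0r.
  rewrite addr0 (bigD1 b) //= [X in _ + X]big1 => [|v vb]; last by rewrite (negbTE vb) andbF mul0r.
  by rewrite !eqxx mul1r addr0.
transitivity (2^-1 * \sum_j c j * (d (p j) (r j) + d (r j) (p j))).
  congr (_ * _).
  under eq_bigr do under eq_bigr do rewrite /multi_weight mulr_suml.
  under eq_bigr do rewrite exchange_big /=.
  rewrite exchange_big /=; apply: eq_bigr => j _.
  rewrite -(D (p j)) -(D (r j)) -big_split mulr_sumr /=; apply: eq_bigr => u _.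
  rewrite -big_split mulr_sumr /=; apply: eq_bigr => v _.
  by rewrite -mulrA mulrDl.
rewrite mulr_sumr; apply: eq_bigr => j _.
by rewrite [d (r j) _]dC; lra.
Qed.

(** [D] is both the terminal metric and a feasible point of (MET), giving [U]. [kappa] keeps the
    optimum positive, and [t0] provides an integral solution, so that the infimum is over a nonempty
    set. *)
Lemma multigraph_instance (k : nat) (T : {set W}) (D : W -> W -> R) (t0 : W) (U L kappa : R) :
  (forall j, 0 <= c j) -> #|T| = k -> t0 \in T -> semimetric_on [set: W] D ->
  \sum_j c j * D (p j) (r j) <= U ->
  (forall f : W -> W, (forall v, f v \in T) -> (forall t, t \in T -> f t = t) ->
     L <= \sum_j c j * D (f (p j)) (f (r j))) ->
  0 < kappa ->
  (forall d, semimetric_on [set: W] d ->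
     (forall s t, s \in T -> t \in T -> s != t -> d s t = D s t) ->
     kappa <= \sum_j c j * d (p j) (r j)) ->
  exists I : zero_ext R k, [/\ 0 < met_opt I, met_opt I <= U & L <= integral_opt I].
Proof.
move=> c0 cT t0T sD hU hL kappa0 hkappa.
have e_sym : symmetric (fun u v : W => u != v) by move=> u v; rewrite eq_sym.
have e_irr : irreflexive (fun u v : W => u != v) by move=> u; rewrite eqxx.
have w_sym u v : u != v -> multi_weight u v = multi_weight v u.
  by move=> _; exact: multi_weight_sym.
have w_ge0 u v : u != v -> 0 <= multi_weight u v.
  by move=> _; apply: sumr_ge0 => j _; rewrite mulr_ge0 // addr_ge0.
have sDT : semimetric_on T D.
  by case: sD => a1 a2 a3 a4; split => *; [apply: a1|apply: a2|apply: a3|apply: a4]; rewrite inE.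
pose I := ZeroExt e_sym e_irr w_sym w_ge0 cT sDT.
have costE (d : W -> W -> R) : (forall u, d u u = 0) -> (forall u v, d u v = d v u) ->
    cost (I := I) d = \sum_j c j * d (p j) (r j).
  by move=> d0 dC; exact: sum_multi_weight.
have semiE (d : W -> W -> R) : semimetric_on [set: W] d ->
    (forall u, d u u = 0) /\ (forall u v, d u v = d v u).
  by case=> a1 _ a3 _; split=> *; [apply: a1|apply: a3]; rewrite inE.
have [D0 DC] := semiE _ sD.
have met_lb x : [set cost (I := I) d | d in met_feasible (I := I)]%classic x -> kappa <= x.
  move=> [d [sd hd] <-]; have [d0 dC] := semiE _ sd.
  by rewrite costE //; exact: hkappa.
have met_D : [set cost (I := I) d | d in met_feasible (I := I)]%classic (cost (I := I) D).
  by exists D => //; split.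
exists I; split.
- apply: lt_le_trans kappa0 _; apply: lb_le_inf; first by exists (cost (I := I) D).
  by move=> x; exact: met_lb.
- apply: le_trans hU; rewrite -costE //; apply: ge_inf => //.
  by exists kappa => x; exact: met_lb.
- apply: lb_le_inf.
    exists (cost (I := I) (fun u v => D (if u \in T then u else t0) (if v \in T then v else t0))).
    exists (fun u => if u \in T then u else t0) => //.
    by split => [v|t ->//]; case: ifP.
  move=> _ [f [fT ft] <-]; rewrite costE //; exact: hL.
Qed.

End Multigraph.

Section Instance.
Variables (R : realType) (V : finType) (G : finZmodType) (F : {set V * V}) (s : V * V -> G).
Variables (I : finType) (g : I -> G) (q M rest : nat).
Local Notation X := (V * G)%type.
Local Notation W := ((X * bool) + 'I_rest)%type.
Local Notation J := ((X * I) + ((V * V) * G) + X)%type.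
Variable x0 : X.

Local Notation dist := (dist F s g q M).

(* [inl (x, true)] is the terminal hanging off [inl (x, false)]; the remaining
   terminals are twins of the one at [x0]. *)
Definition place (u : W) : X * bool := if u is inl a then a else (x0, true).

Definition height (b : bool) : nat := if b then (q ^ 2)%N else 0%N.

Definition ext_dist (u v : W) : nat :=
  if place u == place v then 0%N else
  (height (place u).2 + height (place v).2 + dist (place u).1 (place v).1)%N.

Definition left_end (j : J) : W :=
  match j with
  | inl (inl xi) => inl (xi.1, false)
  | inl (inr eh) => inl ((eh.1.1, eh.2), false)
  | inr x => inl (x, false)
  end.

Definition right_end (j : J) : W :=
  match j with
  | inl (inl xi) => inl ((xi.1.1, xi.1.2 + g xi.2), false)
  | inl (inr eh) => inl ((eh.1.2, eh.2 + s eh.1), false)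
  | inr x => inl (x, true)
  end.

Definition mult (j : J) : R :=
  match j with
  | inl (inl _) => #|I|%:R^-1
  | inl (inr eh) => if eh.1 \in F then q%:R^-1 else 0
  | inr _ => (q%:R ^+ 2)^-1
  end.

Definition ext_terminals : {set W} := [set u | (place u).2].

Hypothesis addxx : forall x : G, x + x = 0.
Hypothesis q0 : (0 < q)%N.
Hypothesis hM : (q ^ 4 < M)%N.
Hypothesis treeF : treelike G (4 * q ^ 3) F.
Hypothesis degF : forall x, (deg F x <= 8)%N.
Hypothesis cardF : (2 * #|V| <= #|F|)%N.
Hypothesis label : forall (u : V -> G) (E : {set V * V}),
  E \subset F -> (7 * #|F| <= 8 * #|E|)%N ->
  exists2 e, e \in E & u e.1 + s e - u e.2 \notin
    (fun A : {set I} => \sum_(i in A) g i) @: [set A : {set I} | (#|A| <= q ^ 3)%N].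
Hypothesis spread : forall psi : G -> X,
  (#|I| * \sum_h \sum_h' (psi h != psi h') <=
   4 * #|G| * \sum_i \sum_h (psi h != psi (h + g i)%R))%N.
Hypothesis gen_neq0 : exists i, g i != 0.

Lemma card_ext_terminals : #|ext_terminals| = (#|V| * #|G| + rest)%N.
Proof.
rewrite -sum1_card big_mkcond big_sumType /=.
congr (_ + _)%N; last first.
  by under eq_bigr do rewrite inE /=; rewrite sum_nat_const card_ord muln1.
transitivity (\sum_(x : X) \sum_(b : bool) b)%N.
  by rewrite (pair_bigA _ (fun _ b => nat_of_bool b)) /=; apply: eq_bigr => -[x []]; rewrite inE.
by under eq_bigr do rewrite big_bool /=; rewrite sum_nat_const card_prod muln1.
Qed.

Lemma ext_dist_xx u : ext_dist u u = 0%N.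
Proof. by rewrite /ext_dist eqxx. Qed.

Lemma ext_dist_sym u v : ext_dist u v = ext_dist v u.
Proof. by rewrite /ext_dist eq_sym (dist_sym _ _ _ _ _ addxx) [(height _ + _)%N]addnC. Qed.

Lemma ext_dist_triangle u v w : (ext_dist u w <= ext_dist u v + ext_dist v w)%N.
Proof.
rewrite /ext_dist.
have [->|uv] := eqVneq (place u) (place v); first by rewrite add0n.
have [<-|vw] := eqVneq (place v) (place w); first by rewrite addn0 (negbTE uv).
case: eqP => // _.
by have := dist_triangle F s g q M (place u).1 (place v).1 (place w).1; lia.
Qed.

Lemma sum_mult (d : W -> W -> R) :
  \sum_j mult j * d (left_end j) (right_end j) =
  #|I|%:R^-1 * (\sum_v \sum_i \sum_h d (inl ((v, h), false)) (inl ((v, h + g i), false))) +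
  q%:R^-1 * (\sum_(e in F) \sum_h d (inl ((e.1, h), false)) (inl ((e.2, h + s e), false))) +
  (q%:R ^+ 2)^-1 * \sum_v \sum_h d (inl ((v, h), false)) (inl ((v, h), true)).
Proof.
rewrite !big_sumType /=; congr (_ + _ + _).
- rewrite -mulr_sumr; congr (_ * _).
  under [RHS]eq_bigr do rewrite exchange_big /=.
  rewrite (pair_bigA _ (fun v h => \sum_i _)) /=.
  by rewrite (pair_bigA _ (fun x i => _)) /=; apply: eq_bigr => -[[v h] i].
- rewrite mulr_sumr [RHS]big_mkcond /=.
  rewrite -(pair_bigA _ (fun e h => (if e \in F then q%:R^-1 else 0) *
     d (inl ((e.1, h), false)) (inl ((e.2, h + s e), false)))) /=.
  apply: eq_bigr => e _; case: ifP => _; first by rewrite mulr_sumr.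
  by rewrite big1 // => h _; rewrite mul0r.
- rewrite -mulr_sumr; congr (_ * _).
  by rewrite (pair_bigA _ (fun v h => _)) /=; apply: eq_bigr => -[v h].
Qed.

Local Notation n := #|V|.
Local Notation m := #|G|.

(** Weights are inverse to lengths: fibre edges cost at most [nm], base edges [4nm] because degrees
    at most 8 give [#|F| <= 4n], and terminal edges [nm]. *)
Lemma met_bound :
  \sum_j mult j * (ext_dist (left_end j) (right_end j))%:R <= 6 * (n * m)%N%:R.
Proof.
have [i0 _] := gen_neq0.
have I0 : (0 < #|I|)%N by apply/card_gt0P; exists i0.
rewrite (sum_mult (fun u v => (ext_dist u v)%:R)).
have H1 : (\sum_v \sum_i \sum_h ext_dist (inl ((v, h), false)) (inl ((v, h + g i)%R, false)) <=
    #|I| * (n * m))%N.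
  apply: (@leq_trans (\sum_(v : V) \sum_(i : I) \sum_(h : G) 1)%N); last first.
    by rewrite !sum_nat_const muln1 mulnCA.
  apply: leq_sum => v _; apply: leq_sum => i _; apply: leq_sum => h _.
  by rewrite /ext_dist; case: ifP => // _; exact: dist_fibre.
have H2 : (\sum_(e in F) \sum_h ext_dist (inl ((e.1, h), false)) (inl ((e.2, h + s e)%R, false)) <=
    q * (4 * (n * m)))%N.
  apply: (@leq_trans (\sum_(e in F) \sum_(h : G) q)%N).
    apply: leq_sum => e eF; apply: leq_sum => h _.
    by rewrite /ext_dist; case: ifP => // _; exact: dist_base.
  rewrite !sum_nat_const.
  have hF : (2 * #|F| <= 8 * n)%N.
    have := sum_deg F (fun=> 1%N); rewrite sum_nat_const mulnC => ->.
    rewrite mulnC -sum_nat_const; apply: leq_sum => v _; by rewrite muln1.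
  apply: (@leq_trans (4 * n * (m * q))%N); last by move: #|V| #|G| => a b; lia.
  by rewrite leq_mul2r; apply/orP; right; move: hF; move: #|F| #|V| => a b; lia.
have H3 : (\sum_v \sum_h ext_dist (inl ((v, h), false)) (inl ((v, h), true)) <= q ^ 2 * (n * m))%N.
  apply: (@leq_trans (\sum_(v : V) \sum_(h : G) q ^ 2)%N); last first.
    by rewrite !sum_nat_const mulnA [leqRHS]mulnC.
  apply: leq_sum => v _; apply: leq_sum => h _.
  by rewrite /ext_dist /= dist_xx addn0; case: ifP.
have sumE (A B : finType) (P : pred A) (f : A -> B -> nat) :
    \sum_(a | P a) \sum_b (f a b)%:R = (\sum_(a | P a) \sum_b f a b)%N%:R :> R.
  by rewrite natr_sum; apply: eq_bigr => a _; rewrite natr_sum.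
rewrite /= !sumE.
under eq_bigr do rewrite sumE.
rewrite -natr_sum.
have qp : 0 < q%:R :> R by rewrite ltr0n.
have Ip : 0 < #|I|%:R :> R by rewrite ltr0n.
rewrite [leRHS](_ : _ = (n * m)%N%:R + 4 * (n * m)%N%:R + (n * m)%N%:R); last by lra.
rewrite !lerD // mulrC ler_pdivrMr ?exprn_gt0 // -?natrX -!natrM ler_nat.
- by rewrite mulnC.
- by rewrite [leqRHS]mulnC.
- by rewrite [leqRHS]mulnC.
Qed.

(** A fibre edge whose ends get different [phi] costs at least [2q^2], as terminals at different
    places are that far apart; other edges cost at least the [dist] in [total_bound], and [spread]
    bounds the fibre defects. *)
Lemma integral_bound (f : W -> W) :
  (forall v, f v \in ext_terminals) -> (forall t, t \in ext_terminals -> f t = t) ->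
  q%:R ^+ 2 * (n * m)%N%:R / 64 <=
  \sum_j mult j * (ext_dist (f (left_end j)) (f (right_end j)))%:R.
Proof.
move=> fT ft.
have [i0 _] := gen_neq0.
have I0 : (0 < #|I|)%N by apply/card_gt0P; exists i0.
have m0 : (0 < m)%N by apply/card_gt0P; exists 0.
pose phi x := (place (f (inl (x, false)))).1.
have fE x : place (f (inl (x, false))) = (phi x, true).
  by have := fT (inl (x, false)); rewrite inE /phi; case: (place _) => a b /= ->.
have dE u v : (dist (place u).1 (place v).1 <= ext_dist u v)%N.
  by rewrite /ext_dist; case: eqP => [->|_]; rewrite ?dist_xx ?leq_addl.
rewrite (sum_mult (fun u v => (ext_dist (f u) (f v))%:R)).
pose A1 := (\sum_v \sum_i \sum_h (phi (v, h) != phi (v, h + g i)%R))%N.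
pose A2 := (\sum_(e in F) \sum_h dist (phi (e.1, h)) (phi (e.2, h + s e)%R))%N.
pose A3 := (\sum_v \sum_h dist (v, h) (phi (v, h)))%N.
have H1 : (2 * q ^ 2 * A1)%N%:R <= \sum_v \sum_i \sum_h
    (ext_dist (f (inl ((v, h), false))) (f (inl ((v, h + g i), false))))%:R :> R.
  rewrite /A1 big_distrr natr_sum /=; apply: ler_sum => v _.
  rewrite big_distrr natr_sum /=; apply: ler_sum => i _.
  rewrite big_distrr natr_sum /=; apply: ler_sum => h _.
  rewrite ler_nat /ext_dist !fE xpair_eqE andbT; case: eqP => [|_] /=; first by rewrite muln0.
  by rewrite muln1 mul2n -addnn leq_addr.
have H2 : A2%:R <= \sum_(e in F) \sum_h
    (ext_dist (f (inl ((e.1, h), false))) (f (inl ((e.2, h + s e), false))))%:R :> R.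
  rewrite natr_sum; apply: ler_sum => e _; rewrite natr_sum; apply: ler_sum => h _.
  by rewrite ler_nat; apply: leq_trans (dE _ _); rewrite !fE.
have H3 : A3%:R <= \sum_v \sum_h
    (ext_dist (f (inl ((v, h), false))) (f (inl ((v, h), true))))%:R :> R.
  rewrite natr_sum; apply: ler_sum => v _; rewrite natr_sum; apply: ler_sum => h _.
  rewrite ler_nat; apply: leq_trans (dE _ _); rewrite fE ft ?inE //=.
  by rewrite (dist_sym _ _ _ _ _ addxx).
have qp : 0 < q%:R :> R by rewrite ltr0n.
have Ip : 0 < #|I|%:R :> R by rewrite ltr0n.
apply: (@le_trans _ _ (#|I|%:R^-1 * (2 * q ^ 2 * A1)%N%:R + q%:R^-1 * A2%:R + (q%:R ^+ 2)^-1 * A3%:R));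
  last by rewrite !lerD // ler_wpM2l // ltW // invr_gt0 ?exprn_gt0.
have key : (#|I| * (q ^ 4 * n * m) <= 128 * q ^ 4 * A1 + 4 * #|I| * (q * A2) + 32 * #|I| * A3)%N.
  have B1 := total_bound addxx q0 hM treeF degF cardF label phi.
  have B2 : (#|I| * \sum_v fibre_defect phi v <= 4 * m * A1)%N.
    rewrite /A1 !big_distrr /=; apply: leq_sum => v _.
    exact: (spread (fun h => phi (v, h))).
  rewrite -(leq_pmul2r m0); move: B1 B2; rewrite -/A2 -/A3 => B1 B2.
  clear H1 H2 H3; clearbody A1 A2 A3; move: B1 B2.
  move: (\sum_v fibre_defect _ _)%N (q ^ 4)%N #|I| => S Q K.
  move=> /(leq_mul (leqnn K)) B1 /(leq_mul (leqnn (32 * Q)%N)) B2.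
  move: B1 B2; move: #|V| #|G| A1 A2 A3 => n' m' A1' A2' A3'; clear; lia.
(* Clearing denominators turns the goal into [key] with slack: 64 replaces 4 and 32. *)
rewrite -(ler_pM2l (_ : 0 < 64 * #|I|%:R * q%:R ^+ 2 :> R)); last first.
  by rewrite !mulr_gt0 ?exprn_gt0.
rewrite [leLHS](_ : _ = (#|I| * (q ^ 4 * n * m))%N%:R); last first.
  by rewrite !(natrX, natrM); field.
rewrite [leRHS](_ : _ = (128 * q ^ 4 * A1 + 64 * #|I| * (q * A2) + 64 * #|I| * A3)%N%:R); last first.
  by rewrite !(natrD, natrX, natrM); field; rewrite ?gt_eqF //.
rewrite ler_nat; apply: leq_trans key _.
by rewrite !leq_add // !leq_mul.
Qed.

(** Two terminals over neighbours in a fibre are at least [2q^2] apart, and each of the three edges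
    joining them is at most the total cost divided by its weight. *)
Lemma met_pos (d : W -> W -> R) : semimetric_on [set: W] d ->
  (forall u v, u \in ext_terminals -> v \in ext_terminals -> u != v -> d u v = (ext_dist u v)%:R) ->
  q%:R ^+ 2 / (q%:R ^+ 2 + #|I|%:R) <= \sum_j mult j * d (left_end j) (right_end j).
Proof.
move=> [_ d_ge0 dC d_tri] dE; have [i0 gi0] := gen_neq0.
have I0 : (0 < #|I|)%N by apply/card_gt0P; exists i0.
have qp : 0 < q%:R :> R by rewrite ltr0n.
have Ip : 0 < #|I|%:R :> R by rewrite ltr0n.
have mult_ge0 j : 0 <= mult j.
  by case: j => [[?|e]|?] /=; rewrite ?invr_ge0 ?exprn_ge0 //; case: ifP; rewrite ?invr_ge0.
set S := \sum_j _.
have leS j : mult j * d (left_end j) (right_end j) <= S.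
  rewrite /S (bigD1 j) //= lerDl; apply: sumr_ge0 => i _.
  by rewrite mulr_ge0 // d_ge0 ?inE.
pose y0 : X := (x0.1, x0.2 + g i0).
have xy : x0 != y0.
  apply: contra_neq gi0 => /(congr1 snd) /= /eqP.
  by rewrite -subr_eq0 opprD addrA subrr add0r oppr_eq0 => /eqP.
have h (c x : R) : 0 < c -> c^-1 * x <= S -> x <= S * c.
  by move=> c0; rewrite mulrC ler_pdivrMr.
have h1 : d (inl (x0, false)) (inl (y0, false)) <= S * #|I|%:R.
  exact: h Ip (leS (inl (inl (x0, i0)))).
have q2p : 0 < q%:R ^+ 2 :> R by rewrite exprn_gt0.
have h2 := h _ _ q2p (leS (inr x0)); have h3 := h _ _ q2p (leS (inr y0)).
move: h2 h3; rewrite /= => h2 h3.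
have h4 : 2 * q%:R ^+ 2 <= d (inl (x0, true)) (inl (y0, true)).
  rewrite dE ?inE //; last by apply: contra_neq xy => -[].
  rewrite -natrX -natrM ler_nat /ext_dist /= xpair_eqE (negbTE xy) /=.
  by rewrite mul2n -addnn leq_addr.
have t1 := d_tri (inl (x0, true)) (inl (x0, false)) (inl (y0, true)) (in_setT _) (in_setT _) (in_setT _).
have t2 := d_tri (inl (x0, false)) (inl (y0, false)) (inl (y0, true)) (in_setT _) (in_setT _) (in_setT _).
have c1 := dC (inl (x0, true)) (inl (x0, false)) (in_setT _) (in_setT _).
rewrite ler_pdivrMr ?addr_gt0 //.
have S0 : 0 <= S.
  by apply: sumr_ge0 => i _; rewrite mulr_ge0 // d_ge0 ?inE.
have := mulr_ge0 S0 (ltW Ip).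
rewrite mulrDr; lra.
Qed.

Lemma gap_instance : exists J : zero_ext R (n * m + rest)%N,
  [/\ 0 < met_opt J, met_opt J <= 6 * (n * m)%N%:R &
      q%:R ^+ 2 * (n * m)%N%:R / 64 <= integral_opt J].
Proof.
apply: (@multigraph_instance R W J left_end right_end mult _ ext_terminals
  (fun u v => (ext_dist u v)%:R) (inl (x0, true)) _ _ (q%:R ^+ 2 / (q%:R ^+ 2 + #|I|%:R))).
- by case=> [[?|e]|?] /=; rewrite ?invr_ge0 ?exprn_ge0 //; case: ifP; rewrite ?invr_ge0.
- exact: card_ext_terminals.
- by rewrite inE.
- split=> [u _|u v _ _|u v _ _|u v w _ _ _]; rewrite ?ext_dist_xx ?ler0n //.
    by rewrite ext_dist_sym.
  by rewrite -natrD ler_nat ext_dist_triangle.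
- exact: met_bound.
- exact: integral_bound.
- by rewrite divr_gt0 ?addr_gt0 ?exprn_gt0 ?ltr0n //; have [i _] := gen_neq0; apply/card_gt0P; exists i.
- exact: met_pos.
Qed.

End Instance.

(** * Choice of the parameters *)

(** With [Q = q^3]: dimension [128Q], [512Q] generators and [#|V| = 2 ^ (20Q)], hence [2 ^ (148Q)]
    points in the extension. *)
Lemma gap_instance_size (R : realType) (q rest : nat) : (0 < q)%N ->
  exists J : zero_ext R (2 ^ (148 * q ^ 3) + rest)%N,
  [/\ 0 < met_opt J, met_opt J <= 6 * (2 ^ (148 * q ^ 3))%N%:R &
      q%:R ^+ 2 * (2 ^ (148 * q ^ 3))%N%:R / 64 <= integral_opt J].
Proof.
move=> q0; set Q := (q ^ 3)%N; have Q0 : (0 < Q)%N by rewrite expn_gt0 q0.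
have w0 : (0 < 64 * Q)%N by lia.
have [g hg] := good_code w0.
set G := 'rV['F_2]_(2 * (64 * Q)) in g hg *.
set I := 'I_(8 * (64 * Q)) in g hg *.
have cG : #|{: G}| = (2 ^ (128 * Q))%N.
  by rewrite card_mx card_Fp // mul1n mulnA.
have cI : #|I| = (8 * (64 * Q))%N by rewrite card_ord.
pose V := 'I_(32 ^ (4 * Q)).
have cV : #|V| = (32 ^ (4 * Q))%N by rewrite card_ord.
have [F [treeF degF cF]] : exists F : {set V * V},
    [/\ treelike G (4 * Q) F, (forall x, (deg F x <= 8)%N) & (8 * #|V| <= 4 * #|F|)%N].
  apply: exists_treelike; first by lia.
  (* [2 ^ (4Q) * 16 ^ (4Q)] dominates the [2 * 9 ^ (4Q)] required for degree 8 and radius [4Q]. *)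
  rewrite cV -[32%N]/(2 * 16)%N expnMn leq_mul //.
    by rewrite -{1}(expn1 2) leq_exp2l //; lia.
  by rewrite leq_exp2r //; lia.
have {}cF : (2 * #|V| <= #|F|)%N by move: cF; move: #|V| #|F| => a b; lia.
have V0 : (0 < #|V|)%N by rewrite cV expn_gt0.
pose B := (fun A : {set I} => \sum_(i in A) g i) @: [set A : {set I} | (#|A| <= Q)%N].
have cB : (#|B| <= 2 ^ (15 * Q))%N.
  apply: leq_trans (leq_imset_card _ _) _; apply: leq_trans (card_ball (j := 64) _ cI) _ => //.
  by rewrite -[(2 * 64)%N]/(2 ^ 7)%N -expnM -expnD leq_exp2l //; lia.
have [s hs] := exists_label Q0 V0 cF cG cB.
have gen_neq0 : exists i, g i != 0.
  have j0 : (0 < 2 * (64 * Q))%N by lia.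
  pose a : G := delta_mx 0 (Ordinal j0).
  have a0 : a != 0.
    apply/eqP => /rowP /(_ (Ordinal j0)); rewrite !mxE !eqxx /= => /eqP.
    by rewrite oner_eq0.
  have /card_gt0P[i] := leq_trans w0 (hg a a0).
  rewrite inE => hi; exists i; apply: contraNneq hi => ->.
  by rewrite /dot trmx0 mulmx0 mxE.
have spread (psi : G -> (V * G)%type) :
    (#|I| * \sum_h \sum_h' (psi h != psi h') <=
     4 * #|G| * \sum_i \sum_h (psi h != psi (h + g i)%R))%N.
  (* Here [w = #|I| / 8], so [2w] is a quarter of [#|I|]. *)
  have := poincare psi hg; rewrite cI.
  move: (\sum_h _)%N (\sum_i _)%N #|G| => a b c; lia.
have /card_gt0P[v0 _] := V0.
have hM : (q ^ 4 < (q ^ 4).+1)%N by [].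
have eN : (2 ^ (148 * Q) = #|V| * #|G|)%N.
  by rewrite cV cG -[32%N]/(2 ^ 5)%N -expnM -expnD; congr (2 ^ _)%N; lia.
rewrite eN.
exact: (gap_instance R rest (v0, 0) (@addvv _) q0 hM treeF degF cF hs spread gen_neq0).
Qed.

(** [ln k <= 148 (2q)^3 = 1184 q^3 <= (11q)^3], by [ln 2 <= 1] and [q + 1 <= 2q]. *)
Lemma ln_powR_le (R : realType) (k q : nat) : (0 < q)%N -> (0 < k)%N ->
  (k <= 2 ^ (148 * q.+1 ^ 3))%N -> ln (k%:R : R) `^ (2 / 3) <= 121 * q%:R ^+ 2.
Proof.
move=> q0 k0 hk.
have ln2 : ln (2 : R) <= 1.
  by rewrite [2](_ : _ = 1 + 1) //; apply: le_ln1Dx; lra.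
have h1 : ln (k%:R : R) <= (11 * q%:R) ^+ 3.
  apply: (@le_trans _ _ (ln ((2 : R) ^+ (148 * q.+1 ^ 3)%N))).
    by rewrite ler_ln ?posrE ?ltr0n ?exprn_gt0 // -natrX ler_nat.
  rewrite lnXn // -[leLHS]mulr_natr.
  apply: (@le_trans _ _ (1 * (148 * q.+1 ^ 3)%N%:R)); first by rewrite ler_wpM2r.
  rewrite mul1r -natrM -natrX ler_nat expnMn.
  apply: (@leq_trans (148 * (2 * q) ^ 3)%N).
    by rewrite leq_mul2l leq_exp2r //; lia.
  by rewrite expnMn mulnA leq_mul.
have k1 : 0 <= ln (k%:R : R) by rewrite ln_ge0 // ler1n.
apply: le_trans (ge0_ler_powR _ _ _ h1) _; rewrite ?nnegrE ?exprn_ge0 ?mulr_ge0 //.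
rewrite -powR_mulrn ?mulr_ge0 // -powRrM [3 * _](_ : _ = 2); last by field.
rewrite powR_mulrn ?mulr_ge0 //.
by rewrite (_ : _ ^+ 2 = 121 * q%:R ^+ 2) //; ring.
Qed.

Theorem theorem1p1 (R : realType) :
  exists c : R, 0 < c /\
  exists k0 : nat, forall k : nat, (k0 <= k)%N ->
    (exists I : zero_ext R k,
       0 < met_opt I /\
       c * (ln (k%:R : R) `^ (2 / 3)) * met_opt I <= integral_opt I) /\
    ((c * (ln (k%:R : R) `^ (2 / 3)))%:E <= integrality_gap R k)%E.
Proof.
(* The instance has ratio at least [q^2 / (64 * 6)], and [ln_powR_le] costs the factor 121. *)
exists (64 * 6 * 121)^-1; split; first by rewrite invr_gt0.
exists (2 ^ (148 * 1 ^ 3))%N => k hk.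
have bound q : (2 ^ (148 * q ^ 3) <= k)%N -> (q <= k)%N.
  apply: leq_trans; apply: leq_trans (ltnW (ltn_expl q (isT : 1 < 2)%N)) _.
  rewrite leq_exp2l //; case: q => // q.
  by rewrite (expnS _ 2) mulnCA leq_pmulr // muln_gt0 expn_gt0.
(* The largest [q] whose construction fits in [k] terminals; twins fill up the rest. *)
have [q hq maxq] := ex_maxnP (ex_intro (fun q => 2 ^ (148 * q ^ 3) <= k)%N 1%N hk) bound.
have q0 : (0 < q)%N by exact: maxq hk.
have hk1 : (k <= 2 ^ (148 * q.+1 ^ 3))%N.
  by rewrite leqNgt; apply/negP => /ltnW /maxq; rewrite ltnn.
have k0 : (0 < k)%N by apply: leq_trans hq; rewrite expn_gt0.
have [I [met0 metU intL]] : exists I : zero_ext R k,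
    [/\ 0 < met_opt I, met_opt I <= 6 * (2 ^ (148 * q ^ 3))%N%:R &
      q%:R ^+ 2 * (2 ^ (148 * q ^ 3))%N%:R / 64 <= integral_opt I].
  by have := gap_instance_size R (k - 2 ^ (148 * q ^ 3))%N q0; rewrite subnKC.
have gap : (64 * 6 * 121)^-1 * (ln (k%:R : R) `^ (2 / 3)) * met_opt I <= integral_opt I.
  apply: le_trans intL; set N := (_ ^ _)%N%:R in metU *.
  have L := ln_powR_le R q0 k0 hk1.
  rewrite -mulrA; apply: (@le_trans _ _ ((64 * 6 * 121)^-1 * (121 * q%:R ^+ 2 * (6 * N)))).
    by rewrite ler_wpM2l ?invr_ge0 // ler_pM ?powR_ge0 // ltW.
  by rewrite le_eqVlt; apply/orP; left; apply/eqP; field.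
split; first by exists I.
apply: (@le_trans _ _ (integral_opt I / met_opt I)%:E); last first.
  by apply: ereal_sup_ubound; exists I.
by rewrite lee_fin ler_pdivlMr.
Qed.
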